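(* Suppose $f:[a,b]\to\mathbb{R}$ is a continuous $\Phi$-affine function. Then for any $n\in\mathbb{N}$, $$\max\Big\{f\Big(\frac{a+b}{2}\Big)-E_n,\ \frac{f(a)+f(b)}{2}-\frac{n^2-1}{6}\Phi\Big(\frac{b-a}{n}\Big)\Big\}\leq\frac{1}{b-a}\mathcal{T}_{n}(f)$$ and $$\frac{1}{b-a}\mathcal{T}_{n}(f)\leq\min\Big\{f\Big(\frac{a+b}{2}\Big)+E_n,\ \frac{f(a)+f(b)}{2}+\frac{n^2-1}{6}\Phi\Big(\frac{b-a}{n}\Big)\Big\},$$ where $$E_n=\begin{cases}\frac{n^2+2}{12}\Phi\left(\frac{b-a}{n}\right), & \text{if } n \text{ is even},\\[0.1cm] \frac{n^2-1}{12}\Phi\left(\frac{b-a}{n}\right)+\Phi\left(\frac{b-a}{2n}\right), & \text{if } n \text{ is odd}.\end{cases}$$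
   Context: Let $a<b$ be real numbers. $\mathbb{N}$ denotes the set of positive integers and $\mathbb{R}_+$ the set of nonnegative reals. $\Phi:[0,b-a]\to\mathbb{R}_+$ is an arbitrary function (called the error function). A function $f:[a,b]\to\mathbb{R}$ is $\Phi$-convex if $$f(tx+(1-t)y)\leq tf(x)+(1-t)f(y)+t\Phi((1-t)|y-x|)+(1-t)\Phi(t|y-x|)$$ for all $x,y\in[a,b]$ and all $t\in[0,1]$. It is $\Phi$-affine if both $f$ and $-f$ are $\Phi$-convex, i.e. $|f(tx+(1-t)y)-tf(x)-(1-t)f(y)|\leq t\Phi((1-t)|y-x|)+(1-t)\Phi(t|y-x|)$ for all $x,y\in[a,b]$ and all $t\in[0,1]$. For $n\in\mathbb{N}$ put $x_i=a+\frac{(b-a)i}{n}$, $i=0,1,\ldots,n$. The Trapezoidal rule is $$\mathcal{T}_{n}(f)=\frac{b-a}{2n}\Big[f(x_0)+2\sum_{i=1}^{n-1}f(x_i)+f(x_n)\Big].$$ *)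

(* Defs.v *)
From HB Require Import structures.
From mathcomp Require Import all_boot all_order all_algebra.
From mathcomp Require Import all_classical all_reals all_analysis.
Set Implicit Arguments.
Unset Strict Implicit.
Unset Printing Implicit Defensive.
Import Order.TTheory GRing.Theory Num.Theory.
Import numFieldNormedType.Exports.
Local Open Scope classical_set_scope.
Local Open Scope ring_scope.

(* Functions on [a, b] (resp. [0, b - a]) are total functions R -> R of which
   only the values on the interval matter. *)

Definition error_function (R : realType) (a b : R) (Phi : R -> R) : Prop :=
  forall u : R, 0 <= u <= b - a -> 0 <= Phi u.

(* For x, y in [a, b] and t in [0, 1] the arguments of f and of Phi below lie
   in [a, b] and [0, b - a] respectively. *)
Definition Phi_convex (R : realType) (a b : R) (Phi f : R -> R) : Prop :=
  forall x y t : R, a <= x <= b -> a <= y <= b -> 0 <= t <= 1 ->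
    f (t * x + (1 - t) * y) <=
      t * f x + (1 - t) * f y
      + t * Phi ((1 - t) * `|y - x|) + (1 - t) * Phi (t * `|y - x|).

Definition Phi_affine (R : realType) (a b : R) (Phi f : R -> R) : Prop :=
  Phi_convex a b Phi f /\ Phi_convex a b Phi (fun x => - f x).

Definition node (R : realType) (a b : R) (n i : nat) : R :=
  a + (b - a) * i%:R / n%:R.

Definition trapezoidal (R : realType) (a b : R) (n : nat) (f : R -> R) : R :=
  (b - a) / (2 * n%:R) *
    (f (node a b n 0%N) + 2 * (\sum_(1 <= i < n) f (node a b n i))
     + f (node a b n n)).

Definition midpoint_error (R : realType) (a b : R) (Phi : R -> R) (n : nat)
    : R :=
  if odd n then
    (n%:R ^+ 2 - 1) / 12 * Phi ((b - a) / n%:R) + Phi ((b - a) / (2 * n%:R))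
  else (n%:R ^+ 2 + 2) / 12 * Phi ((b - a) / n%:R).

(* Main.v *)
Require Import Defs.
From HB Require Import structures.
From mathcomp Require Import all_boot all_order all_algebra.
From mathcomp Require Import all_classical all_reals all_analysis.
From mathcomp Require Import zify ring lra.
Set Implicit Arguments.
Unset Strict Implicit.
Import Order.TTheory GRing.Theory Num.Theory.
Import numFieldNormedType.Exports.
Local Open Scope classical_set_scope.
Local Open Scope ring_scope.

(** Both bounds are a discrete Hermite-Hadamard inequality.  Put
    h = (b - a) / n and let g i be the value of f at the i-th node.  Taking
    t = 1/2 between the nodes i and i + 2 bounds the second differences of g
    below by - 2 Phi h, so g i - Phi h * i (n - i) is a convex sequence.  Its
    symmetrization s i = g i + g (n - i) - 2 Phi h * i (n - i) is convex and
    symmetric, hence largest at 0 and smallest at n./2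
    ([symmetric_convex_bounds]).

    The trapezoidal mean of f is half the average of g i + g (n - i) over
    i < n ([trapezoidal_mean]), so averaging s (n./2) <= s i <= s 0 encloses
    it; the constant (n^2 - 1) / 6 is the average of i (n - i).  The upper
    bound involves s 0 = f a + f b.  In the lower one, s (n./2) is made of
    the values of f at the central nodes: for n even both are the midpoint,
    for n odd they are at distance h and one more use of t = 1/2 between them
    reaches the midpoint, at the cost Phi (h / 2).

    Phi-convexity alone thus gives one inequality for each comparison value
    ([Phi_convex_hermite_hadamard]); the theorem is this result for f and
    for - f. *)

(** Increments of a convex sequence grow, and symmetry makes the increments
    at i and n - 1 - i opposite; so those of the first half are at most their
    own opposites. *)
Lemma symmetric_convex_bounds (R : realDomainType) (n : nat) (s : nat -> R) :
  (forall i, (i <= n)%N -> s (n - i)%N = s i) ->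
  (forall i, (i.+2 <= n)%N -> 2 * s i.+1 <= s i + s i.+2) ->
  forall i, (i <= n)%N -> s n./2 <= s i <= s 0%N.
Proof.
move=> s_sym s_cvx.
have incr_le i k : (i + k < n)%N -> s i.+1 - s i <= s (i + k).+1 - s (i + k)%N.
  elim: k => [|k IHk] ltn; first by rewrite addn0.
  have lt1 : (i + k < n)%N by lia.
  have lt2 : ((i + k).+2 <= n)%N by lia.
  have := IHk lt1; have := s_cvx _ lt2; rewrite addnS; lra.
have step i : (i < n./2)%N -> s i.+1 <= s i.
  move=> ltim.
  (* The increments at i and at n - 1 - i are n - (2 i + 1) steps apart. *)
  have lt1 : (i + (n - i.*2.+1) < n)%N by lia.
  have := incr_le _ _ lt1.
  have -> : (i + (n - i.*2.+1)).+1 = (n - i)%N by lia.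
  have -> : (i + (n - i.*2.+1))%N = (n - i.+1)%N by lia.
  rewrite !s_sym; [lra|lia|lia].
have anti i k : (i + k <= n./2)%N -> s (i + k)%N <= s i.
  elim: k => [|k IHk] lem; first by rewrite addn0.
  have lt1 : (i + k < n./2)%N by lia.
  by rewrite addnS (le_trans (step _ lt1)) // IHk // ltnW.
have half i : (i <= n./2)%N -> s n./2 <= s i <= s 0%N.
  move=> leim; apply/andP; split.
    by have := anti i (n./2 - i)%N; rewrite subnKC //; apply.
  by have := anti 0%N i; rewrite add0n; apply.
move=> i lein; have [/half //|ltmi] := leqP i n./2.
by rewrite -(s_sym i) //; apply: half; lia.
Qed.

Lemma sum_mul_complement (R : numFieldType) (n : nat) :
  \sum_(0 <= i < n) (i%:R * (n%:R - i%:R)) = n%:R * (n%:R ^+ 2 - 1) / 6 :> R.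
Proof.
(* The summand depends on n, so the induction is on the number of terms. *)
have H (x : R) k : \sum_(0 <= i < k) (i%:R * (x - i%:R)) =
    x * (k%:R * (k%:R - 1) / 2) - k%:R * (k%:R - 1) * (2 * k%:R - 1) / 6.
  elim: k => [|k IHk]; first by rewrite big_nil; field.
  by rewrite big_nat_recr //= IHk -natr1; field.
by rewrite H; field.
Qed.

Lemma sum_symmetrized (R : pzRingType) (n : nat) (g : nat -> R) : (0 < n)%N ->
  \sum_(0 <= i < n) (g i + g (n - i)%N) =
    g 0%N + 2 * (\sum_(1 <= i < n) g i) + g n.
Proof.
move=> n0; rewrite big_ltn // big_split /= subn0.
have -> : \sum_(1 <= i < n) g (n - i)%N = \sum_(1 <= i < n) g i.
  by rewrite [RHS]big_nat_rev; apply: eq_bigr => i _; rewrite add1n subSS.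
by rewrite mulr_natl mulr2n addrAC.
Qed.

Section Nodes.
Context {R : realType}.
Implicit Types (a b x d : R) (Phi f : R -> R) (n i : nat).

Lemma Phi_convex_midpoint a b Phi f x d : Phi_convex a b Phi f ->
  0 <= d -> a <= x -> x + 2 * d <= b ->
  2 * f (x + d) <= f x + f (x + 2 * d) + 2 * Phi d.
Proof.
move=> fcvx d0 ax xb.
have Hx : a <= x <= b by apply/andP; split; lra.
have Hy : a <= x + 2 * d <= b by apply/andP; split; lra.
have Ht : 0 <= (1 / 2 : R) <= 1 by apply/andP; split; lra.
have := fcvx x (x + 2 * d) (1 / 2) Hx Hy Ht.
have -> : x + 2 * d - x = 2 * d by ring.
rewrite ger0_norm; last lra.
have -> : 1 / 2 * x + (1 - 1 / 2) * (x + 2 * d) = x + d by field.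
have -> : (1 - 1 / 2) * (2 * d) = d by field.
have -> : 1 / 2 * (2 * d) = d by field.
lra.
Qed.

Lemma node_ge a b n i : a <= b -> a <= node a b n i.
Proof.
by move=> ab; rewrite /node lerDl divr_ge0 // mulr_ge0 ?ler0n // subr_ge0.
Qed.

Lemma node_le a b n i : (0 < n)%N -> a <= b -> (i <= n)%N -> node a b n i <= b.
Proof.
move=> n0 ab lein; rewrite /node -lerBrDl ler_pdivrMr ?ltr0n //.
by rewrite ler_wpM2l ?ler_nat // subr_ge0.
Qed.

Lemma node0 a b n : node a b n 0 = a.
Proof. by rewrite /node mulr0 mul0r addr0. Qed.

Lemma noden a b n : (0 < n)%N -> node a b n n = b.
Proof.
by move=> n0; rewrite /node mulfK ?pnatr_eq0 -?lt0n // addrC subrK.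
Qed.

Lemma node_add a b n i k :
  node a b n (i + k) = node a b n i + k%:R * ((b - a) / n%:R).
Proof. by rewrite /node natrD; ring. Qed.

Lemma node_second_difference a b Phi f n i :
  (0 < n)%N -> a <= b -> Phi_convex a b Phi f -> (i.+2 <= n)%N ->
  2 * f (node a b n i.+1) <=
    f (node a b n i) + f (node a b n i.+2) + 2 * Phi ((b - a) / n%:R).
Proof.
move=> n0 ab fcvx lt.
rewrite -(addn2 i) -(addn1 i) !node_add mul1r.
apply: (Phi_convex_midpoint fcvx) => //; first by rewrite divr_ge0 ?subr_ge0.
  exact: node_ge.
by rewrite -node_add addn2 node_le.
Qed.

(** The two central nodes coincide when n is even. *)
Lemma central_nodes a b Phi f n :
  (0 < n)%N -> a <= b -> Phi_convex a b Phi f ->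
  2 * f ((a + b) / 2) <= f (node a b n n./2) + f (node a b n (n - n./2)) +
    (if odd n then 2 * Phi ((b - a) / (2 * n%:R)) else 0).
Proof.
move=> n0 ab fcvx.
have n0R : n%:R != 0 :> R by rewrite pnatr_eq0 -lt0n.
have nE : n%:R = (odd n)%:R + 2 * n./2%:R :> R.
  by rewrite -natrM -natrD mul2n odd_double_half.
case: ifP => oddn; rewrite oddn /= in nE.
  have -> : (n - n./2 = n./2 + 1)%N by lia.
  have n2E : n./2%:R = (n%:R - 1) / 2 :> R by lra.
  set d := (b - a) / (2 * n%:R).
  have hE : 1%:R * ((b - a) / n%:R) = 2 * d by rewrite /d; field.
  have -> : (a + b) / 2 = node a b n n./2 + d.
    by rewrite /node n2E /d; field.
  rewrite node_add hE; apply: (Phi_convex_midpoint fcvx) => //.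
  - by rewrite divr_ge0 ?subr_ge0 // mulr_ge0.
  - exact: node_ge.
  - by rewrite -hE -node_add node_le //; lia.
have -> : (n - n./2 = n./2)%N by lia.
have n2E : n./2%:R = n%:R / 2 :> R by lra.
have -> : node a b n n./2 = (a + b) / 2 by rewrite /node n2E; field.
lra.
Qed.

Lemma trapezoidal_mean a b f n : (0 < n)%N -> a < b ->
  1 / (b - a) * trapezoidal a b n f =
  (\sum_(0 <= i < n) (f (node a b n i) + f (node a b n (n - i)))) /
    (2 * n%:R).
Proof.
move=> n0 ab; rewrite (sum_symmetrized (fun i => f (node a b n i))) //.
rewrite /trapezoidal; field.
by rewrite pnatr_eq0 -lt0n n0 subr_eq0 gt_eqF.
Qed.

(** The corrector i (n - i) has constant second difference - 2, so
    subtracting it Phi h times from each half of the symmetrization cancels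
    the error term 2 Phi h of [node_second_difference] exactly; and, being
    invariant under i -> n - i, it keeps the sequence symmetric. *)
Lemma Phi_convex_hermite_hadamard a b Phi f n :
  (0 < n)%N -> a < b -> Phi_convex a b Phi f ->
  f ((a + b) / 2) - midpoint_error a b Phi n <=
    1 / (b - a) * trapezoidal a b n f <=
  (f a + f b) / 2 + (n%:R ^+ 2 - 1) / 6 * Phi ((b - a) / n%:R).
Proof.
move=> n0 ab fcvx.
have ab' := ltW ab.
have n0R : 0 < n%:R :> R by rewrite ltr0n.
have n_neq0 := lt0r_neq0 n0R.
set P := Phi ((b - a) / n%:R).
pose g i := f (node a b n i).
pose s i := g i + g (n - i)%N - 2 * P * (i%:R * (n%:R - i%:R)).
have s_sym i : (i <= n)%N -> s (n - i)%N = s i.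
  by move=> lein; rewrite /s subKn // natrB //; ring.
have s_cvx i : (i.+2 <= n)%N -> 2 * s i.+1 <= s i + s i.+2.
  move=> lt; rewrite /s.
  have := node_second_difference n0 ab' fcvx lt.
  have lt' : ((n - i.+2).+2 <= n)%N by lia.
  have := node_second_difference n0 ab' fcvx lt'.
  have -> : (n - i.+2).+2 = (n - i)%N by lia.
  have -> : (n - i.+2).+1 = (n - i.+1)%N by lia.
  rewrite -!/(g _) -/P.
  rewrite -[i.+2]addn2 -[i.+1]addn1 !natrD.
  set u : R := i%:R; set v : R := n%:R => H1 H2.
  rewrite -subr_ge0.
  rewrite [leRHS](_ : _ = g i + g (i + 2)%N + 2 * P - 2 * g (i + 1)%N +
    (g (n - (i + 2))%N + g (n - i)%N + 2 * P - 2 * g (n - (i + 1))%N)).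
    by lra.
  by ring.
have s_bnd := symmetric_convex_bounds s_sym s_cvx.
have meanE : 1 / (b - a) * trapezoidal a b n f =
    (\sum_(0 <= i < n) s i) / (2 * n%:R) + P * ((n%:R ^+ 2 - 1) / 6).
  rewrite trapezoidal_mean // /s.
  by rewrite sumrB -mulr_sumr sum_mul_complement; field.
have avg_const (c : R) : \sum_(0 <= i < n) c = 2 * n%:R * (c / 2).
  by rewrite sumr_const_nat subn0 -mulr_natl; field.
have lower : s n./2 / 2 <= (\sum_(0 <= i < n) s i) / (2 * n%:R).
  rewrite ler_pdivlMr ?mulr_gt0 // mulrC -avg_const.
  by apply: ler_sum_nat => i /andP[_ /ltnW/s_bnd/andP[]].
have upper : (\sum_(0 <= i < n) s i) / (2 * n%:R) <= s 0%N / 2.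
  rewrite ler_pdivrMr ?mulr_gt0 // [leRHS]mulrC -avg_const.
  by apply: ler_sum_nat => i /andP[_ /ltnW/s_bnd/andP[]].
have s0E : s 0%N = f a + f b.
  by rewrite /s /g subn0 node0 noden // mul0r mulr0 subr0.
(* The corrector at the centre is n^2 / 4, or (n^2 - 1) / 4 for n odd; hence
   the two coefficients of Phi h in the midpoint error. *)
have smE : s n./2 = g n./2 + g (n - n./2)%N
    - P * ((n%:R ^+ 2 - (odd n)%:R) / 2).
  rewrite /s.
  have -> : n%:R ^+ 2 - (odd n)%:R = 4 * (n./2%:R * (n%:R - n./2%:R)) :> R.
    have -> : n%:R = (odd n)%:R + 2 * n./2%:R :> R.
      by rewrite -natrM -natrD mul2n odd_double_half.
    by case: (odd n) => /=; ring.
  by field.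
rewrite meanE; apply/andP; split; last by rewrite s0E in upper; lra.
have := central_nodes n0 ab' fcvx.
rewrite -!/(g _) /midpoint_error -/P.
by rewrite smE in lower; move: lower; case: (odd n) => /=; lra.
Qed.

End Nodes.

Theorem corollary6 (R : realType) (a b : R) (hab : a < b)
    (Phi : R -> R) (hPhi : error_function a b Phi)
    (f : R -> R) (hcont : {within `[a, b], continuous f})
    (haff : Phi_affine a b Phi f) (n : nat) (hn : (0 < n)%N) :
  Num.max (f ((a + b) / 2) - midpoint_error a b Phi n)
          ((f a + f b) / 2 - (n%:R ^+ 2 - 1) / 6 * Phi ((b - a) / n%:R))
    <= 1 / (b - a) * trapezoidal a b n f
  /\
  1 / (b - a) * trapezoidal a b n f
    <= Num.min (f ((a + b) / 2) + midpoint_error a b Phi n)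
               ((f a + f b) / 2 + (n%:R ^+ 2 - 1) / 6 * Phi ((b - a) / n%:R)).
Proof.
have [fcvx Nfcvx] := haff.
have /andP[mid_le le_ends] := Phi_convex_hermite_hadamard hn hab fcvx.
have /andP[] := Phi_convex_hermite_hadamard hn hab Nfcvx.
have -> : trapezoidal a b n (fun x => - f x) = - trapezoidal a b n f.
  by rewrite /trapezoidal sumrN; ring.
rewrite mulrN => le_mid ends_le.
by rewrite ge_max le_min; split; apply/andP; split => //; lra.
Qed.
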